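(* Let $\mathcal{H}=\Delta+V$ be a positive Schrödinger operator associated to a connected graph $b$ over $(X,m)$ with potential $V\le1$. Let $W:X\to[0,\infty)$ be such that $\Delta-W$ is critical, and let $v$ be its Agmon ground state. If $u\in O(v)$ is an $\mathcal{H}$-harmonic function such that $$\liminf_{x\to\infty}\frac{|u(x)|}{G_1(x)}=0,$$ then $u=0$.
   Context: Setting. $X$ is an infinite countable set with the discrete topology (compact subsets are the finite subsets), and $m:X\to(0,\infty)$ is a strictly positive function, regarded as a measure of full support. A graph $b$ over $(X,m)$ is a symmetric function $b:X\times X\to[0,\infty)$ with zero diagonal and $\sum_{y\in X}b(x,y)<\infty$ for all $x\in X$. Write $x\sim y$ if $b(x,y)>0$; $b$ is connected if any two vertices are joined by a finite path $x=x_0\sim\dots\sim x_n=y$. Let $\mathcal{F}_b=\{f:X\to\mathbb{R}\mid \sum_{y}b(x,y)|f(y)|<\infty \text{ for all }x\in X\}$. The Laplacian is $\Delta f(x)=\Delta_{b,m}f(x)=\frac1{m(x)}\sum_{y\in X}b(x,y)(f(x)-f(y))$ for $f\in\mathcal{F}_b$. A potential is a function $V:X\to\mathbb{R}$, and the Schrödinger operator associated to $b$ and $V$ is $\mathcal{H}f=\Delta f+Vf$, $f\in\mathcal{F}_b$. A function $u$ is $\mathcal{H}$-harmonic (resp. superharmonic) if $u\in\mathcal{F}_b$ and $\mathcal{H}u=0$ (resp. $\ge0$) on $X$. A function $f$ is called positive if $f\ge0$ and $f\neq0$, strictly positive (written $f>0$) if $f(x)>0$ for all $x$. $\mathcal{H}$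 is positive if there is a positive $\mathcal{H}$-superharmonic function on $X$; equivalently, the energy form $\mathcal{Q}(\varphi)=\frac12\sum_{x,y}b(x,y)(\varphi(x)-\varphi(y))^2+\sum_x m(x)V(x)\varphi(x)^2$ is nonnegative for all finitely supported $\varphi$. A positive $\mathcal{H}$ is subcritical if there is a nontrivial $W\ge0$ with $\mathcal{Q}(\varphi)\ge\sum_x m(x)W(x)\varphi(x)^2$ for all finitely supported $\varphi$; a positive $\mathcal{H}$ is critical if it is not subcritical. A positive function $\phi\in\mathcal{F}_b$ is a positive solution of minimal growth at infinity for $\mathcal{H}$ if there is a finite $K_0\subset X$ with $\phi>0$ and $\mathcal{H}\phi=0$ in $X\setminus K_0$, and for every finite $K\supseteq K_0$ and every positive $\psi\in\mathcal{F}_b$ with $\psi>0$ and $\mathcal{H}\psi\ge0$ on $X\setminus K$ and $\phi\le\psi$ on $K$, one has $\phi\le\psi$ on $X\setminus K$. An Agmon ground state of $\mathcal{H}$ is a positive $\mathcal{H}$-harmonic function on $X$ that is a positive solution of minimal growth at infinity. Fix a vertex $o\in X$. $G_1$ is the Green function of $\Delta+1$ at $o$: the smallest strictly positive function $\phi$ with $(\Delta+1)\phi\ge 1_o$, where $1_o$ is the characteristic function of $\{o\}$; it satisfies $(\Delta+1)G_1=1_o$. The limit $x\to\infty$ is taken in the one-point compactification $X\cup\{\infty\}$ (i.e. $x$ leaves every finite set). For $g$ not vanishing outside a finite set, $f\in O(g)$ means $\limsup_{x\to\infty}|f(x)|/|g(x)|<\infty$. *)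

(* Defs.v *)
From HB Require Import structures.
From mathcomp Require Import all_boot all_order all_algebra.
From mathcomp Require Import all_classical all_reals all_analysis.

Set Implicit Arguments.
Unset Strict Implicit.
Unset Printing Implicit Defensive.
Import Order.TTheory GRing.Theory Num.Theory.
Import numFieldNormedType.Exports.

Local Open Scope classical_set_scope.
Local Open Scope ring_scope.

Section Schroedinger.
Context {R : realType} {X : countType}.

(* [esum] is only meaningful for nonnegative families, so a signed family is
   summed through its positive and negative parts. This is the usual sum when
   the family is absolutely summable, and a junk value otherwise. *)
Definition sumr (f : X -> R) : R :=
  fine (\esum_(y in [set: X]) (f^\+ y)%:E)
  - fine (\esum_(y in [set: X]) (f^\- y)%:E).

Definition is_graph (b : X -> X -> R) : Prop :=
  [/\ forall x y, 0 <= b x y,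
      forall x y, b x y = b y x,
      forall x, b x x = 0
    & forall x, (\esum_(y in [set: X]) (b x y)%:E < +oo)%E].

Definition adjacent (b : X -> X -> R) : rel X := fun x y => 0 < b x y.

Definition connected_graph (b : X -> X -> R) : Prop :=
  forall x y, exists2 p : seq X, path (adjacent b) x p & last x p = y.

(* The domain F_b of the formal Laplacian. *)
Definition formal_domain (b : X -> X -> R) : set (X -> R) :=
  [set f | forall x, (\esum_(y in [set: X]) (b x y * `|f y|)%:E < +oo)%E].

Definition laplacian (b : X -> X -> R) (m : X -> R) (f : X -> R) (x : X) : R :=
  (m x)^-1 * sumr (fun y => b x y * (f x - f y)).

Definition schroedinger (b : X -> X -> R) (m V : X -> R) (f : X -> R) (x : X)
    : R :=
  laplacian b m f x + V x * f x.

Definition positive_fun (f : X -> R) : Prop :=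
  (forall x, 0 <= f x) /\ f <> cst 0.

Definition is_harmonic (b : X -> X -> R) (m V u : X -> R) : Prop :=
  formal_domain b u /\ forall x, schroedinger b m V u x = 0.

Definition is_superharmonic (b : X -> X -> R) (m V u : X -> R) : Prop :=
  formal_domain b u /\ forall x, 0 <= schroedinger b m V u x.

Definition positive_op (b : X -> X -> R) (m V : X -> R) : Prop :=
  exists2 u, positive_fun u & is_superharmonic b m V u.

Definition finitely_supported (phi : X -> R) : Prop :=
  finite_set [set x | phi x != 0].

(* The energy form, to be evaluated at finitely supported [phi] only: the sum
   [\sum_(x \in _)] is the sum over the (finite) support of its summand. *)
Definition energy (b : X -> X -> R) (m V phi : X -> R) : \bar R :=
  ((2^-1)%:E * (\esum_(p in [set: X * X])
                   (b p.1 p.2 * (phi p.1 - phi p.2) ^+ 2)%:E)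
   + (\sum_(x \in [set: X]) m x * V x * phi x ^+ 2)%:E)%E.

Definition subcritical (b : X -> X -> R) (m V : X -> R) : Prop :=
  positive_op b m V /\
  exists2 W : X -> R, positive_fun W &
    forall phi, finitely_supported phi ->
      ((\sum_(x \in [set: X]) m x * W x * phi x ^+ 2)%:E
       <= energy b m V phi)%E.

Definition critical (b : X -> X -> R) (m V : X -> R) : Prop :=
  positive_op b m V /\ ~ subcritical b m V.

Definition minimal_growth (b : X -> X -> R) (m V phi : X -> R) : Prop :=
  [/\ positive_fun phi, formal_domain b phi &
    exists K0 : set X, [/\ finite_set K0,
      forall x, ~ K0 x -> 0 < phi x /\ schroedinger b m V phi x = 0 &
      forall (K : set X) (psi : X -> R),
        finite_set K -> K0 `<=` K ->
        positive_fun psi -> formal_domain b psi ->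
        (forall x, ~ K x -> 0 < psi x /\ 0 <= schroedinger b m V psi x) ->
        (forall x, K x -> phi x <= psi x) ->
        forall x, ~ K x -> phi x <= psi x]].

Definition agmon_ground_state (b : X -> X -> R) (m V v : X -> R) : Prop :=
  [/\ positive_fun v, is_harmonic b m V v & minimal_growth b m V v].

(* [G] belongs to, and is a lower bound of, the set of strictly positive [phi]
   in F_b with (Delta + 1) phi >= 1_o. *)
Definition is_green1 (b : X -> X -> R) (m : X -> R) (o : X) (G : X -> R)
    : Prop :=
  let S := [set phi : X -> R |
    [/\ formal_domain b phi,
        forall x, 0 < phi x &
        forall x, \1_[set o] x <= schroedinger b m (cst 1) phi x]] in
  S G /\ forall phi, S phi -> forall x, G x <= phi x.

(* [limf_esup] and [limf_einf] require a topology on the domain, hence the alias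
   [discrete_topology X] of [X]. *)
Definition at_infinity : set_system (discrete_topology X) :=
  [set A | cofinite_set A].

Lemma discrete_compactP (A : set (discrete_topology X)) :
  compact A <-> finite_set A.
Proof.
split=> [cA|/finite_compact//]; apply: contrapT => infA.
pose F : set_system (discrete_topology X) := [set B | finite_set (A `\` B)].
have FF : ProperFilter F.
  split; first by rewrite /F /= setD0.
  split=> [|P Q|P Q PQ]; rewrite /F /=.
  - by rewrite setDT.
  - by rewrite setDIr finite_setU.
  - by apply: sub_finite_set; exact: setDS.
have [|x [_ /(_ (A `\` [set x]) [set x])]] := cA F FF.
  by rewrite /F /= setDv.
case=> [||y [[_ +] //]]; last exact: discrete_set1.
by rewrite /F /= setDD; apply: sub_finite_set (finite_set1 x) => y [].
Qed.

Lemma at_infinityE (A : set (discrete_topology X)) :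
  at_infinity A <->
  nbhs (None : one_point_compactification (discrete_topology X))
    (Some @` A `|` [set None]).
Proof.
split=> [finCA|[C [/discrete_compactP finC _] CA]].
  exists (~` A); last by rewrite setCK.
  by split; [exact/discrete_compactP | exact: discrete_closed].
apply: sub_finite_set finC => x /= nAx; apply: contrapT => nCx.
have /CA[[y Ay [yx]]|//] : (Some @` (~` C) `|` [set None]) (Some x).
  by left; exists x.
by apply: nAx; rewrite -yx.
Qed.

Definition limsup_infty (f : X -> \bar R) : \bar R :=
  @limf_esup _ (discrete_topology X) _ f at_infinity.

Definition liminf_infty (f : X -> \bar R) : \bar R :=
  @limf_einf _ (discrete_topology X) _ f at_infinity.

(* Meant for [g] without zeros outside a finite set. *)
Definition bigO_infty (f g : X -> R) : Prop :=
  (limsup_infty (fun x => (`|f x| / `|g x|)%:E) < +oo)%E.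

End Schroedinger.

(* Main.v *)
Require Import Defs.
From HB Require Import structures.
From mathcomp Require Import all_boot all_order all_algebra.
From mathcomp Require Import all_classical all_reals all_analysis.
From mathcomp Require Import ring lra.

(** Write [H] for the operator with potential [V], [H0] for the critical
    operator with potential [- W] and ground state [v], and let [w > 0] be
    [H]-superharmonic.

    The ground state transform ([ground_state_transform]) is the identity
    [Q(u e) = Psi_u(e) + \sum_x m x * H u x * u x * e x ^+ 2], where [Psi_u] is
    the energy of [e] with the edge weights [b x y * u x * u y]. The potential
    no longer occurs in [Psi_u], so that energies of different operators become
    comparable: [|u| <= C v] implies [Psi_u <= C ^ 2 Psi_v].

    As [H0] is critical, some [v e] has small [H0]-energy relative to its value
    at a given vertex, that is, [Psi_v(e)] is small. Since [u] is [H]-harmonic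
    and [w] is [H]-superharmonic,
      [Psi_w(u e / w) <= Q_H(u e) = Psi_u(e) <= C ^ 2 Psi_v(e)].
    At an edge, smallness of [Psi_v(e)] makes [e] almost constant, and smallness
    of [Psi_w(u e / w)] makes [u e / w] almost constant. Hence [u / w] takes the
    same value at both ends of every edge ([ratio_edge]), and [u = c w] for some
    constant [c] since the graph is connected. This is a Liouville comparison
    principle.

    As [V <= 1], the function [w] is also superharmonic for [Delta + 1], and is
    therefore bounded below by a positive multiple of [G1] ([green1_le]). If
    [c != 0], then [|u| / G1 = |c| w / G1] is bounded away from zero, which
    contradicts the hypothesis on the limit inferior. *)

Set Implicit Arguments.
Unset Strict Implicit.
Unset Printing Implicit Defensive.
Import Order.TTheory GRing.Theory Num.Theory.
Import numFieldNormedType.Exports.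

Local Open Scope classical_set_scope.
Local Open Scope ring_scope.

(** * Sums of absolutely summable families *)

Section SignedSums.
Context {R : realType} {X : countType}.
Implicit Types (f g p q : X -> R) (s : seq X).

Definition abs_summable f : Prop := (\esum_(y in [set: X]) `|f y|%:E < +oo)%E.

Lemma esum_fin_num f : (forall y, 0 <= f y) ->
  (\esum_(y in [set: X]) (f y)%:E < +oo)%E ->
  \esum_(y in [set: X]) (f y)%:E \is a fin_num.
Proof.
move=> f0 fS; rewrite ge0_fin_numE//.
by apply: esum_ge0 => y _; rewrite lee_fin.
Qed.

Lemma esumZl (D : set X) (c : R) f : 0 <= c ->
  \esum_(y in D) (c * f y)%:E = (c%:E * \esum_(y in D) (f y)%:E)%E.
Proof.
move=> c0; rewrite /esum -ereal_supZl//; last first.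
  apply/set0P; exists 0%E; exists set0; first exact: fsets_set0.
  by rewrite fsbig_set0.
rewrite image_comp; congr ereal_sup; apply: eq_imagel => A [finA _] /=.
by rewrite !fsbig_finite//= !sumEFin -EFinM mulr_sumr.
Qed.

Lemma abs_summable_le f g : (forall y, `|f y| <= g y) ->
  (\esum_(y in [set: X]) (g y)%:E < +oo)%E -> abs_summable f.
Proof.
by move=> fg; apply: le_lt_trans; apply: le_esum => y _; rewrite lee_fin.
Qed.

Lemma abs_summableZ (c : R) f : abs_summable f ->
  abs_summable (fun y => c * f y).
Proof.
move=> fS; apply: (@abs_summable_le _ (fun y => `|c| * `|f y|)).
  by move=> y; rewrite normrM.
by rewrite esumZl// lte_mul_pinfty// lee_fin.
Qed.

Lemma abs_summable_restr (P : pred X) f : abs_summable f ->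
  abs_summable (fun y => if P y then f y else 0).
Proof.
move=> fS; apply: (@abs_summable_le _ (fun y => `|f y|)) => // y.
by case: ifP; rewrite ?normr0.
Qed.

(** Any decomposition of a signed family as a difference of nonnegative
    summable ones computes its sum, because [p + f^\- = q + f^\+]; this is what
    makes [sumr] linear in spite of the parts [f^\+] and [f^\-] not being so. *)
Lemma sumr_decomp f p q : (forall y, 0 <= p y) -> (forall y, 0 <= q y) ->
  (\esum_(y in [set: X]) (p y)%:E < +oo)%E ->
  (\esum_(y in [set: X]) (q y)%:E < +oo)%E ->
  (forall y, f y = p y - q y) ->
  sumr f = fine (\esum_(y in [set: X]) (p y)%:E)
           - fine (\esum_(y in [set: X]) (q y)%:E).
Proof.
move=> p0 q0 pS qS fpq.
have pE : forall y, 0 <= f^\+ y <= p y.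
  move=> y; rewrite funrpos_ge0/= /funrpos/= fpq ge_max p0 andbT.
  by rewrite gerBl.
have nE : forall y, 0 <= f^\- y <= q y.
  move=> y; rewrite funrneg_ge0/= /funrneg/= fpq ge_max q0 andbT.
  by rewrite opprB gerBl.
have pF : (\esum_(y in [set: X]) (f^\+ y)%:E < +oo)%E.
  apply: le_lt_trans pS; apply: le_esum => y _.
  by rewrite lee_fin; case/andP: (pE y).
have nF : (\esum_(y in [set: X]) (f^\- y)%:E < +oo)%E.
  apply: le_lt_trans qS; apply: le_esum => y _.
  by rewrite lee_fin; case/andP: (nE y).
have : (\esum_(y in [set: X]) (f^\+ y)%:E + \esum_(y in [set: X]) (q y)%:E
     = \esum_(y in [set: X]) (f^\- y)%:E + \esum_(y in [set: X]) (p y)%:E)%E.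
  rewrite -!esumD; do ?by move=> y _; rewrite lee_fin.
  apply: eq_esum => y _; rewrite -!EFinD; congr EFin.
  have := congr1 (fun h => h y) (funrposBneg f); rewrite fctE /= fpq fctE.
  lra.
move/(congr1 fine); rewrite !fineD ?esum_fin_num// => H.
by rewrite /sumr; lra.
Qed.

Lemma ge0_sumr f : (forall y, 0 <= f y) -> 
  sumr f = fine (\esum_(y in [set: X]) (f y)%:E).
Proof.
move=> f0; rewrite /sumr (eq_esum (b := fun y => (f y)%:E)); last first.
  by move=> y _; congr EFin; apply/max_idPl.
rewrite [X in _ - fine X]esum1 ?subr0// => y _.
by rewrite /funrneg max_r// oppr_le0.
Qed.

Lemma sumr_fct_ge0 f : (forall y, 0 <= f y) -> 0 <= sumr f.
Proof.
move=> f0; rewrite ge0_sumr// fine_ge0// esum_ge0// => y _.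
by rewrite lee_fin.
Qed.

Lemma abs_summable_pos f : abs_summable f ->
  (\esum_(y in [set: X]) (f^\+ y)%:E < +oo)%E.
Proof.
apply: le_lt_trans; apply: le_esum => y _.
by rewrite lee_fin /funrpos ge_max ler_norm /=.
Qed.

Lemma abs_summable_neg f : abs_summable f ->
  (\esum_(y in [set: X]) (f^\- y)%:E < +oo)%E.
Proof.
apply: le_lt_trans; apply: le_esum => y _.
by rewrite lee_fin /funrneg ge_max normr_ge0 andbT -normrN ler_norm.
Qed.

Lemma sumr_fctD f g : abs_summable f -> abs_summable g ->
  sumr (fun y => f y + g y) = sumr f + sumr g.
Proof.
move=> fS gS.
have [fp fn] := (abs_summable_pos fS, abs_summable_neg fS).
have [gp gn] := (abs_summable_pos gS, abs_summable_neg gS).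
rewrite (@sumr_decomp _ (fun y => f^\+ y + g^\+ y) (fun y => f^\- y + g^\- y)).
- under eq_esum do rewrite EFinD.
  under [in X in _ - X]eq_esum do rewrite EFinD.
  rewrite !esumD; do ?by move=> y _; rewrite lee_fin.
  by rewrite !fineD ?esum_fin_num// /sumr opprD addrACA.
- by move=> y; rewrite addr_ge0.
- by move=> y; rewrite addr_ge0.
- under eq_esum do rewrite EFinD.
  by rewrite esumD ?lte_add_pinfty// => y _; rewrite lee_fin.
- under eq_esum do rewrite EFinD.
  by rewrite esumD ?lte_add_pinfty// => y _; rewrite lee_fin.
- move=> y; have := congr1 (fun h => h y) (funrposBneg f).
  have := congr1 (fun h => h y) (funrposBneg g); rewrite !fctE /=; lra.
Qed.

Lemma sumr_fctN f : sumr (fun y => - f y) = - sumr f.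
Proof.
rewrite /sumr opprB; congr (_ - _).
by congr fine; apply: eq_esum => y _; rewrite /funrneg opprK.
Qed.

Lemma sumr_fctZ (c : R) f : abs_summable f ->
  sumr (fun y => c * f y) = c * sumr f.
Proof.
move=> fS; wlog c0 : c / 0 <= c => [wlg|].
  have [/wlg//|c0] := leP 0 c.
  have := wlg (- c); rewrite oppr_ge0 (ltW c0) => /(_ isT).
  under eq_fun do rewrite mulNr.
  by rewrite sumr_fctN mulNr => /oppr_inj.
have [fp fn] := (abs_summable_pos fS, abs_summable_neg fS).
rewrite (@sumr_decomp _ (fun y => c * f^\+ y) (fun y => c * f^\- y)).
- by rewrite !esumZl// !fineM ?esum_fin_num// /sumr mulrBr.
- by move=> y; rewrite mulr_ge0.
- by move=> y; rewrite mulr_ge0.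
- by rewrite esumZl// lte_mul_pinfty// lee_fin.
- by rewrite esumZl// lte_mul_pinfty// lee_fin.
- move=> y; have := congr1 (fun h => h y) (funrposBneg f).
  by rewrite fctE /= -mulrBr => <-.
Qed.

Lemma sumr_fctB f g : abs_summable f -> abs_summable g ->
  sumr (fun y => f y - g y) = sumr f - sumr g.
Proof.
move=> fS gS; rewrite -sumr_fctN -sumr_fctD//.
have := abs_summableZ (-1) gS; under eq_fun do rewrite mulN1r; exact.
Qed.

Lemma le_sumr_fct f g : abs_summable f -> abs_summable g ->
  (forall y, f y <= g y) -> sumr f <= sumr g.
Proof.
move=> fS gS fg; rewrite -subr_ge0 -sumr_fctB//.
by apply: sumr_fct_ge0 => y; rewrite subr_ge0.
Qed.

Lemma sumr_finite s f : uniq s -> (forall y, y \notin s -> f y = 0) ->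
  sumr f = \sum_(y <- s) f y.
Proof.
move=> us f0.
have finE g : (forall y, 0 <= g y) -> (forall y, y \notin s -> g y = 0) ->
    fine (\esum_(y in [set: X]) (g y)%:E) = \sum_(y <- s) g y.
  move=> g0 gs; rewrite (esumID [set` s])//; last first.
    by move=> y _; rewrite lee_fin.
  rewrite !setTI [X in (_ + X)%E]esum1 => [|y /negP /gs ->//].
  rewrite adde0 esum_fset; last 2 first.
  - exact: finite_seq.
  - by move=> y _; rewrite lee_fin.
  by rewrite -fsbig_seq//= sumEFin.
rewrite /sumr !finE; first 1 last.
- by move=> y; exact: funrneg_ge0.
- by move=> y /f0 fy; rewrite /funrneg fy oppr0 maxxx.
- by move=> y; exact: funrpos_ge0.
- by move=> y /f0 fy; rewrite /funrpos fy maxxx.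
rewrite -sumrB; apply: eq_bigr => y _.
by have := congr1 (fun h => h y) (funrposBneg f).
Qed.

(** Isolating the finitely many terms in [s] leaves this single number of the
    infinite sum, so that the rest of the argument is finite algebra. *)
Definition tail s f : R := sumr (fun y => if y \notin s then f y else 0).

Lemma sumr_tail s f : uniq s -> abs_summable f ->
  sumr f = \sum_(y <- s) f y + tail s f.
Proof.
move=> us fS.
rewrite (_ : \sum_(y <- s) f y = sumr (fun y => if y \in s then f y else 0)).
  rewrite /tail -sumr_fctD; do ?exact: abs_summable_restr.
  by congr sumr; apply/funext => y; case: ifP; rewrite ?addr0 ?add0r.
rewrite (@sumr_finite s)//; last by move=> y /negbTE ->.
by rewrite big_seq [RHS]big_seq; apply: eq_bigr => y ->.
Qed.

Lemma le_tail s f g : abs_summable f -> abs_summable g ->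
  (forall y, f y <= g y) -> tail s f <= tail s g.
Proof.
move=> fS gS fg; apply: le_sumr_fct; do ?exact: abs_summable_restr.
by move=> y; case: ifP.
Qed.

Lemma tailZ s (c : R) f : abs_summable f ->
  tail s (fun y => c * f y) = c * tail s f.
Proof.
move=> fS; rewrite -sumr_fctZ; last exact: abs_summable_restr.
by congr sumr; apply/funext => y; case: ifP; rewrite ?mulr0.
Qed.

Lemma tail_ge0 s f : (forall y, 0 <= f y) -> 0 <= tail s f.
Proof. by move=> f0; apply: sumr_fct_ge0 => y; case: ifP. Qed.

Lemma esum_tail s f : (forall y, 0 <= f y) -> abs_summable f ->
  \esum_(y in ~` [set` s]) (f y)%:E = (tail s f)%:E.
Proof.
move=> f0 fS; rewrite esum_mkcond /tail ge0_sumr; last by move=> y; case: ifP.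
rewrite fineK.
  apply: eq_esum => y _; rewrite in_setC.
  rewrite (_ : (y \in [set` s]) = (y \in s)); first by case: ifP.
  by apply/idP/idP; rewrite inE.
apply: esum_fin_num; first by move=> y; case: ifP.
apply: le_lt_trans fS; apply: le_esum => y _; rewrite lee_fin.
by case: ifP; rewrite // ger0_norm.
Qed.

Lemma esum_seq s (f : X -> \bar R) : uniq s -> (forall y, (0 <= f y)%E) ->
  \esum_(y in [set` s]) f y = (\sum_(y <- s) f y)%E.
Proof.
move=> us f0; rewrite esum_fset; first by rewrite -fsbig_seq.
- exact: finite_seq.
- by [].
Qed.

End SignedSums.

(** * The energy of a finitely supported function *)

Section SchroedingerOperators.
Context {R : realType} {X : countType}.
Variables (b : X -> X -> R) (m : X -> R).
Hypothesis b_graph : is_graph b.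
Hypothesis m_gt0 : forall x, 0 < m x.
Implicit Types (f g u v w phi V : X -> R) (s : seq X).

Let b_ge0 x y : 0 <= b x y. Proof. by case: b_graph. Qed.
Let b_sym x y : b x y = b y x. Proof. by case: b_graph. Qed.

Lemma graph_summable x : abs_summable (b x).
Proof.
case: b_graph => _ _ _ /(_ x); apply: abs_summable_le => y.
by rewrite ger0_norm.
Qed.

Lemma domain_summable u : formal_domain b u ->
  forall x, abs_summable (fun y => b x y * u y).
Proof.
move=> uD x; apply: abs_summable_le (uD x) => y.
by rewrite normrM ger0_norm.
Qed.

Lemma formal_domain_le u v : (forall x, `|u x| <= `|v x|) ->
  formal_domain b v -> formal_domain b u.
Proof.
move=> uv vD x; apply: le_lt_trans (vD x); apply: le_esum => y _.
by rewrite lee_fin ler_wpM2l.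
Qed.

Lemma formal_domainZ (c : R) u :
  formal_domain b u -> formal_domain b (fun x => c * u x).
Proof.
move=> uD x; under eq_esum do rewrite normrM mulrCA.
by rewrite esumZl// lte_mul_pinfty// lee_fin.
Qed.

Lemma laplacianE u x : formal_domain b u ->
  m x * laplacian b m u x
  = sumr (b x) * u x - sumr (fun y => b x y * u y).
Proof.
move=> uD; rewrite /laplacian mulVKf ?gt_eqF//.
under eq_fun do rewrite mulrBr mulrC.
rewrite sumr_fctB.
- by rewrite sumr_fctZ// 1?mulrC//; exact: graph_summable.
- by apply: abs_summableZ; exact: graph_summable.
- exact: domain_summable.
Qed.

(** The form of the Laplacian that matches [transformed_form]. *)
Lemma laplacian_tail s u x : uniq s -> formal_domain b u ->
  m x * laplacian b m u x
  = \sum_(y <- s) b x y * (u x - u y)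
    + tail s (b x) * u x - tail s (fun y => b x y * u y).
Proof.
move=> us uD; rewrite laplacianE// !(sumr_tail us)//; last first.
- exact: graph_summable.
- exact: domain_summable.
under [in RHS]eq_bigr do rewrite mulrBr.
by rewrite sumrB -mulr_suml; ring.
Qed.

(** For [phi] supported in [s], this is half the sum of
    [b x y * u x * u y * (phi x - phi y) ^+ 2] over all pairs: a pair with one
    end outside [s] contributes [phi x ^+ 2] times its weight, once in each
    order, and these contributions make up the first sum. *)
Definition transformed_form s u phi : R :=
  \sum_(x <- s) u x * tail s (fun y => b x y * u y) * phi x ^+ 2
  + 2^-1 * \sum_(x <- s) \sum_(y <- s)
             b x y * (u x * u y) * (phi x - phi y) ^+ 2.

(** The infinitely many rows [x \notin s] contribute, after exchanging the order
    of summation, the same amount as the tails of the rows [x \in s]; this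
    cancels the factor one half in front of the tail terms. *)
Lemma energyE s V phi : uniq s -> (forall x, x \notin s -> phi x = 0) ->
  energy b m V phi =
  (transformed_form s (cst 1) phi
   + \sum_(x <- s) m x * V x * phi x ^+ 2)%:E.
Proof.
move=> us phi0; rewrite /energy.
pose f x y := b x y * (phi x - phi y) ^+ 2.
have f0 x y : 0 <= f x y by rewrite mulr_ge0// sqr_ge0.
have rowE x : (\esum_(y in [set: X]) (f x y)%:E
    = (\sum_(y <- s) f x y + tail s (b x) * phi x ^+ 2)%:E)%E.
  rewrite (esumID [set` s]); last by move=> y _; rewrite lee_fin.
  rewrite !setTI esum_seq//; last by move=> y; rewrite lee_fin.
  rewrite sumEFin EFinD; congr (_ + _)%E.
  rewrite mulrC -tailZ; last exact: graph_summable.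
  rewrite -esum_tail; last 2 first.
  - by move=> y; rewrite mulr_ge0// sqr_ge0.
  - by apply: abs_summableZ; exact: graph_summable.
  by apply: eq_esum => y /negP /phi0 yz; rewrite /f yz subr0 mulrC.
have row_offE x : x \notin s ->
    (\esum_(y in [set: X]) (f x y)%:E
     = \sum_(y <- s) (phi y ^+ 2 * b y x)%:E)%E.
  move=> /phi0 xz; rewrite rowE xz expr0n/= mulr0 addr0 sumEFin; congr EFin.
  by apply: eq_bigr => y _; rewrite /f xz sub0r sqrrN mulrC b_sym.
have -> : (\esum_(p in [set: X * X]) (b p.1 p.2 * (phi p.1 - phi p.2) ^+ 2)%:E
    = \esum_(x in [set: X]) \esum_(y in [set: X]) (f x y)%:E)%E.
  rewrite (esum_esum (J := fun=> setT))//; last first.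
    by move=> x y _ _; rewrite lee_fin.
  by congr esum; apply/seteqP; split.
rewrite (esumID [set` s]); last first.
  by move=> x _; apply: esum_ge0 => y _; rewrite lee_fin.
rewrite !setTI esum_seq//; last first.
  by move=> x; apply: esum_ge0 => y _; rewrite lee_fin.
under eq_bigr do rewrite rowE.
rewrite sumEFin.
have -> : (\esum_(x in ~` [set` s]) \esum_(y in [set: X]) (f x y)%:E
    = (\sum_(y <- s) tail s (b y) * phi y ^+ 2)%:E)%E.
  under eq_esum => x /= /negP xs do rewrite row_offE//.
  rewrite esum_sum; last by move=> x y _ _; rewrite lee_fin mulr_ge0// sqr_ge0.
  rewrite -sumEFin; apply: eq_bigr => y _.
  rewrite esumZl ?sqr_ge0// esum_tail//; last exact: graph_summable.
  by rewrite mulrC EFinM.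
have -> : \sum_(x \in [set: X]) m x * V x * phi x ^+ 2
    = \sum_(x <- s) m x * V x * phi x ^+ 2.
  rewrite (fsbigE s)//; first by apply: eq_bigl => x; rewrite in_setT.
  by move=> x _ /phi0 ->; rewrite expr0n mulr0.
rewrite -!EFinD; congr EFin; rewrite /transformed_form.
have -> : \sum_(x <- s) cst 1 x * tail s (fun y => b x y * cst 1 y) * phi x ^+ 2
    = \sum_(x <- s) tail s (b x) * phi x ^+ 2.
  apply: eq_bigr => x _; rewrite mul1r; congr (tail _ _ * _).
  by apply/funext => y; rewrite mulr1.
have -> : \sum_(x <- s) \sum_(y <- s)
      b x y * (cst 1 x * cst 1 y) * (phi x - phi y) ^+ 2
    = \sum_(x <- s) \sum_(y <- s) f x y.
  by apply: eq_bigr => x _; apply: eq_bigr => y _; rewrite !mulr1.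
rewrite big_split/=; set A := \sum_(x <- s) \sum_(y <- s) _.
set B := \sum_(x <- s) tail _ _ * _; lra.
Qed.

(** * The ground state transform *)

(** Substitute [laplacian_tail] for [H u]: the terms with [tail s (b x)] and those
    with the potential cancel.
    What is left is the double sum over [s], where symmetrizing
    [b x y * (u x - u y) * u x * phi x ^+ 2] in [x] and [y] turns
    [(u x * phi x - u y * phi y) ^+ 2] into [u x * u y * (phi x - phi y) ^+ 2]. *)
Lemma ground_state_transform s V u phi :
  uniq s -> (forall x, x \notin s -> phi x = 0) -> formal_domain b u ->
  energy b m V (fun x => u x * phi x) =
  (transformed_form s u phi
   + \sum_(x <- s) m x * schroedinger b m V u x * u x * phi x ^+ 2)%:E.
Proof.
move=> us phi0 uD; rewrite (energyE V us)//; last first.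
  by move=> x /phi0 ->; rewrite mulr0.
congr EFin; rewrite /transformed_form /schroedinger.
pose T x := tail s (fun y => b x y * u y).
have -> : \sum_(x <- s) m x * (laplacian b m u x + V x * u x) * u x * phi x ^+ 2
    = \sum_(x <- s) \sum_(y <- s) b x y * (u x - u y) * u x * phi x ^+ 2
      + \sum_(x <- s) tail s (b x) * (u x * phi x) ^+ 2
      - \sum_(x <- s) u x * T x * phi x ^+ 2
      + \sum_(x <- s) m x * V x * (u x * phi x) ^+ 2.
  rewrite -big_split -sumrB -big_split/=; apply: eq_bigr => x _.
  rewrite mulrDr (laplacian_tail x us uD) -!mulr_suml -/(T x).
  by ring.
have -> : \sum_(x <- s) cst 1 x * tail s (fun y => b x y * cst 1 y)
                        * (u x * phi x) ^+ 2
    = \sum_(x <- s) tail s (b x) * (u x * phi x) ^+ 2.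
  apply: eq_bigr => x _; rewrite mul1r; congr (tail _ _ * _).
  by apply/funext => y; rewrite mulr1.
have symE : \sum_(x <- s) \sum_(y <- s) b x y * (u x - u y) * u x * phi x ^+ 2
    = 2^-1 * \sum_(x <- s) \sum_(y <- s)
        b x y * (u x - u y) * (u x * phi x ^+ 2 - u y * phi y ^+ 2).
  have swap : \sum_(x <- s) \sum_(y <- s) b x y * (u x - u y) * u x * phi x ^+ 2
      = \sum_(x <- s) \sum_(y <- s)
          - (b x y * (u x - u y) * (u y * phi y ^+ 2)).
    rewrite exchange_big/=; apply: eq_bigr => x _; apply: eq_bigr => y _.
    by rewrite (b_sym y x); ring.
  have half (A B : R) : A = B -> A = 2^-1 * (A + B) by move=> ->; lra.
  rewrite (half _ _ swap).
  rewrite -big_split/=; congr (_ * _); apply: eq_bigr => x _.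
  by rewrite -big_split/=; apply: eq_bigr => y _; ring.
have -> : 2^-1 * \sum_(x <- s) \sum_(y <- s)
      b x y * (cst 1 x * cst 1 y) * (u x * phi x - u y * phi y) ^+ 2
    = 2^-1 * \sum_(x <- s) \sum_(y <- s)
        b x y * (u x * u y) * (phi x - phi y) ^+ 2
      + 2^-1 * \sum_(x <- s) \sum_(y <- s)
        b x y * (u x - u y) * (u x * phi x ^+ 2 - u y * phi y ^+ 2).
  rewrite -mulrDr -big_split/=; congr (_ * _); apply: eq_bigr => x _.
  by rewrite -big_split/=; apply: eq_bigr => y _ /=; ring.
by rewrite symE /T; ring.
Qed.

(** Every term of the form is nonnegative, and the two orders of the pair
    [x, y] make up for the factor one half. *)
Lemma transformed_form_edge s w phi x y : uniq s -> x \in s -> y \in s ->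
  (forall z, 0 <= w z) ->
  b x y * (w x * w y) * (phi x - phi y) ^+ 2 <= transformed_form s w phi.
Proof.
move=> us xs ys w0; rewrite /transformed_form.
set g := fun x y => b x y * (w x * w y) * (phi x - phi y) ^+ 2.
have g0 p q : 0 <= g p q.
  by rewrite /g mulr_ge0 ?sqr_ge0// mulr_ge0// mulr_ge0.
rewrite -[X in X <= _]add0r lerD//.
  apply: sumr_ge0 => z _; rewrite mulr_ge0 ?sqr_ge0// mulr_ge0//.
  by apply: tail_ge0 => q; rewrite mulr_ge0.
have [->|xy] := eqVneq x y.
  rewrite subrr expr0n mulr0 mulr_ge0//.
  by apply: sumr_ge0 => p _; apply: sumr_ge0 => q _; exact: g0.
have yrem : y \in rem x s by rewrite mem_rem_uniq// inE eq_sym xy.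
rewrite (big_rem x xs)/= (big_rem y yrem)/=.
rewrite (big_rem y ys)/= [X in _ + (X + _)](big_rem x xs)/=.
have A : 0 <= \sum_(z <- rem y s) g x z by apply: sumr_ge0 => z _; exact: g0.
have B : 0 <= \sum_(z <- rem x s) g y z by apply: sumr_ge0 => z _; exact: g0.
have C : 0 <= \sum_(p <- rem y (rem x s)) \sum_(q <- s) g p q.
  by apply: sumr_ge0 => p _; apply: sumr_ge0 => q _; exact: g0.
have -> : b y x * (w y * w x) * (phi y - phi x) ^+ 2 = g x y.
  by rewrite /g b_sym; ring.
rewrite -/(g x y); move: A B C; rewrite /g; lra.
Qed.

(** Both forms see only the products [u x * u y] and [v x * v y], and
    [|u| <= C v] gives [u x * u y <= C ^+ 2 * (v x * v y)] whatever the sign of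
    [u]. *)
Lemma transformed_form_le s u v phi (C : R) :
  formal_domain b u -> formal_domain b v -> (forall x, 0 <= v x) -> 0 <= C ->
  (forall x, `|u x| <= C * v x) ->
  transformed_form s u phi <= C ^+ 2 * transformed_form s v phi.
Proof.
move=> uD vD v0 C0 uv.
have uu x y : u x * u y <= C ^+ 2 * (v x * v y).
  rewrite (le_trans (ler_norm _))// normrM.
  rewrite (_ : C ^+ 2 * _ = (C * v x) * (C * v y)); last by ring.
  by rewrite ler_pM.
rewrite /transformed_form mulrDr lerD//.
  rewrite mulr_sumr; apply: ler_sum => x _.
  rewrite mulrA ler_wpM2r ?sqr_ge0//.
  rewrite mulrA -!tailZ//; last 2 first.
  - exact: domain_summable.
  - exact: domain_summable.
  apply: le_tail; do ?by apply: abs_summableZ; exact: domain_summable.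
  move=> y; rewrite mulrCA [leRHS](_ : _ = b x y * (C ^+ 2 * (v x * v y))).
    by rewrite ler_wpM2l.
  by ring.
rewrite mulrCA ler_wpM2l// mulr_sumr; apply: ler_sum => x _.
rewrite mulr_sumr; apply: ler_sum => y _.
by rewrite [leRHS]mulrA ler_wpM2r ?sqr_ge0// [leRHS]mulrCA ler_wpM2l.
Qed.

(** * Superharmonic functions *)

Lemma connected_propagate (P : X -> Prop) : connected_graph b ->
  (forall x y, 0 < b x y -> P x -> P y) -> forall x y, P x -> P y.
Proof.
move=> bc Pstep x y Px; have [p xp <-] := bc x y.
elim: p x Px xp => //= z p IH x Px /andP[xz zp].
exact: IH (Pstep _ _ xz Px) zp.
Qed.

(** Minimum principle: at a zero of [u] the inequality [0 <= H u] reads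
    [\sum_y b x y * u y <= 0], so [u] also vanishes at all neighbours. *)
Lemma superharmonic_gt0 V u : connected_graph b ->
  positive_fun u -> is_superharmonic b m V u -> forall x, 0 < u x.
Proof.
move=> bc [u0 uN0] [uD uH] x; rewrite lt0r u0 andbT; apply/eqP => ux.
apply: uN0; apply/funext => y; move: x y ux.
apply: (connected_propagate bc) => x y bxy ux; apply/eqP.
rewrite eq_le u0 andbT -(pmulr_rle0 _ bxy).
have : 0 <= m x * laplacian b m u x.
  by have := uH x; rewrite /schroedinger ux mulr0 addr0; apply/mulr_ge0/ltW.
rewrite laplacianE// ux mulr0 sub0r oppr_ge0; apply: le_trans.
rewrite (@sumr_tail _ _ [:: y])//; last exact: domain_summable.
by rewrite big_seq1 lerDl tail_ge0// => z; rewrite mulr_ge0.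
Qed.

(** Raising a function away from [x] lowers its image at [x]. In particular the
    minimum of two supersolutions is again one. *)
Lemma schroedinger_le V f g x : formal_domain b f -> formal_domain b g ->
  (forall y, f y <= g y) -> f x = g x ->
  schroedinger b m V g x <= schroedinger b m V f x.
Proof.
move=> fD gD fg fgx; rewrite /schroedinger fgx lerD2r -(ler_pM2l (m_gt0 x)).
rewrite !laplacianE// fgx lerD2l lerN2.
by apply: le_sumr_fct => [||y]; rewrite ?ler_wpM2l//; exact: domain_summable.
Qed.

Lemma schroedingerZ V (c : R) u x : formal_domain b u ->
  schroedinger b m V (fun y => c * u y) x = c * schroedinger b m V u x.
Proof.
move=> uD; have m0 : m x != 0 by rewrite gt_eqF.
apply: (mulfI m0); rewrite /schroedinger mulrDr [RHS]mulrCA.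
rewrite [X in _ = c * X]mulrDr !laplacianE//; last exact: formal_domainZ.
under eq_fun do rewrite mulrCA.
by rewrite sumr_fctZ; [ring | exact: domain_summable].
Qed.

(** * The Liouville comparison principle *)

(** Otherwise the multiple [e / m x] of the indicator of [x] would be a Hardy
    weight, and the operator subcritical. *)
Lemma critical_null V x (e : R) : critical b m V -> 0 < e ->
  exists2 phi, finitely_supported phi &
    (energy b m V phi < (e * phi x ^+ 2)%:E)%E.
Proof.
move=> [Vpos Vcrit] e0; apply: contrapT => noPhi; apply: Vcrit; split=> //.
exists (fun z => if z == x then e / m x else 0).
  split=> [z|/(congr1 (@^~ x))/=]; first by case: ifP; rewrite ?divr_ge0// ltW.
  by rewrite eqxx => /eqP; rewrite gt_eqF// divr_gt0.
move=> phi phiF; rewrite leNgt; apply/negP => Ephi; apply: noPhi.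
exists phi => //; apply: lt_le_trans Ephi _.
rewrite (fsbigE [:: x])//; last first.
  by move=> z _; rewrite inE => /negbTE ->; rewrite mulr0 mul0r.
rewrite big_mkcond big_seq1/= in_setT eqxx lee_fin (mulrC (m x)) divfK//.
by rewrite gt_eqF.
Qed.

(** The Liouville comparison on one edge. A function [phi = v h] of small energy
    relative to [phi x] has [h y / h x] close to [1]; and with [g = u / w] the
    chain [Psi_w(g h) <= Psi_u(h) <= C ^ 2 Psi_v(h)] makes [g y * h y / h x]
    close to [g x]. Hence [g y = g x]. *)
Lemma ratio_edge V0 V u v w (C : R) : critical b m V0 ->
  is_harmonic b m V0 v -> (forall x, 0 < v x) ->
  is_harmonic b m V u -> 0 <= C -> (forall x, `|u x| <= C * v x) ->
  is_superharmonic b m V w -> (forall x, 0 < w x) ->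
  forall x y, 0 < b x y -> u x / w x = u y / w y.
Proof.
move=> V0crit [vD vH] v0 [uD uH] C0 uv [wD wH] w0 x y bxy.
pose g z := u z / w z; rewrite -/(g x) -/(g y).
pose c1 := b x y * (v x * v y); pose c2 := b x y * (w x * w y).
have c10 : 0 < c1 by rewrite !mulr_gt0.
have c20 : 0 < c2 by rewrite !mulr_gt0.
(* The error constant: [(g x - g y) ^+ 2 <= 2 * (g x - t * g y) ^+ 2
   + 2 * (1 - t) ^+ 2 * g y ^+ 2] with [t = h y / h x], and the two squares on
   the right are at most [C ^+ 2 * e * v x ^+ 2 / c2] and
   [e * v x ^+ 2 / c1]. *)
pose K := 2 * v x ^+ 2 * (C ^+ 2 / c2 + g y ^+ 2 / c1).
have K0 : 0 <= K.
  apply: mulr_ge0; first by rewrite mulr_ge0// sqr_ge0.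
  by apply: addr_ge0; rewrite divr_ge0 ?sqr_ge0// ltW.
suff main (e : R) : 0 < e -> (g x - g y) ^+ 2 <= e * K.
  apply/eqP; rewrite -subr_eq0 -sqrf_eq0 eq_le sqr_ge0 andbT.
  apply/ler_addgt0Pl => e e0; rewrite addr0.
  have K1 : 0 < K + 1 by rewrite ltr_wpDl.
  apply: le_trans (main (e / (K + 1)) _) _; first by rewrite divr_gt0.
  by rewrite mulrAC ler_pdivrMr// ler_wpM2l ?ltW// ltrDl.
move=> e0; have [phi phiF phiE] := critical_null x V0crit e0.
have [s0 s0E] := (finite_seqP _).1 phiF.
pose s := undup [:: x, y & s0]; have us : uniq s by exact: undup_uniq.
have xs : x \in s by rewrite mem_undup inE eqxx.
have ys : y \in s by rewrite mem_undup !inE eqxx orbT.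
have phi0 z : z \notin s -> phi z = 0.
  move=> zs; apply/eqP; apply: contraNT zs => phiz.
  have : [set` s0] z by rewrite -s0E.
  by rewrite mem_undup !inE /= => ->; rewrite !orbT.
pose h z := phi z / v z.
have h0 z : z \notin s -> h z = 0 by move=> /phi0 hz; rewrite /h hz mul0r.
have vh : phi = (fun z => v z * h z).
  by apply/funext => z; rewrite /h mulrCA divff ?mulr1// gt_eqF.
have gh0 z : z \notin s -> g z * h z = 0 by move=> /h0 ->; rewrite mulr0.
have vE : transformed_form s v h < e * (v x * h x) ^+ 2.
  move: phiE; rewrite vh (ground_state_transform _ us h0 vD).
  rewrite big1 ?addr0 ?lte_fin// => z _.
  by rewrite vH mulr0 !mul0r.
have wE : transformed_form s w (fun z => g z * h z)
    <= transformed_form s u h.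
  have : energy b m V (fun z => w z * (g z * h z))
       = energy b m V (fun z => u z * h z).
    congr energy; apply/funext => z.
    by rewrite mulrA; congr (_ * _); rewrite mulrC divfK// gt_eqF.
  rewrite (ground_state_transform _ us gh0 wD).
  rewrite (ground_state_transform _ us h0 uD) => -[].
  rewrite [X in _ = _ + X -> _]big1 => [|z _]; last by rewrite uH mulr0 !mul0r.
  rewrite addr0 => <-; rewrite lerDl; apply: sumr_ge0 => z _.
  by apply: mulr_ge0 (sqr_ge0 _); rewrite !mulr_ge0// ltW.
have uE := transformed_form_le s h uD vD (fun z => ltW (v0 z)) C0 uv.
have w_edge := transformed_form_edge (fun z => g z * h z) us xs ys
  (fun z => ltW (w0 z)).
have v_edge := transformed_form_edge h us xs ys
  (fun z => ltW (v0 z)).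
rewrite -/c1 in v_edge; rewrite -/c2 in w_edge.
have v_small := le_lt_trans v_edge vE.
(* The energy bound is strict and the form is nonnegative, so that [phi] cannot
   vanish at [x]; this makes it possible to normalize by [h x]. *)
have hx0 : h x != 0.
  apply: contraTneq v_small => ->; rewrite mulr0 expr0n mulr0 -leNgt.
  by rewrite mulr_ge0 ?sqr_ge0// ltW.
have w_small :
    c2 * (g x * h x - g y * h y) ^+ 2 <= C ^+ 2 * (e * (v x * h x) ^+ 2).
  rewrite (le_trans w_edge)// (le_trans wE)// (le_trans uE)//.
  by rewrite ler_wpM2l ?sqr_ge0// ltW.
pose t := h y / h x; have hy : h y = t * h x by rewrite /t divfK.
have hx2 : 0 < h x ^+ 2 by rewrite exprn_even_gt0.
have v1 : (1 - t) ^+ 2 <= e * v x ^+ 2 / c1.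
  rewrite ler_pdivlMr// -(ler_pM2r hx2); move: (ltW v_small).
  by rewrite hy; congr (_ <= _); ring.
have w1 : (g x - t * g y) ^+ 2 <= C ^+ 2 * e * v x ^+ 2 / c2.
  rewrite ler_pdivlMr// -(ler_pM2r hx2); move: w_small.
  by rewrite hy; congr (_ <= _); ring.
have -> : e * K = 2 * (C ^+ 2 * e * v x ^+ 2 / c2)
                  + 2 * (e * v x ^+ 2 / c1) * g y ^+ 2.
  by rewrite /K; ring.
apply: (@le_trans _ _ (2 * (g x - t * g y) ^+ 2 + 2 * (1 - t) ^+ 2 * g y ^+ 2)).
  rewrite -subr_ge0 (_ : _ - _ = (g x - t * g y + (1 - t) * g y) ^+ 2).
    exact: sqr_ge0.
  by ring.
by rewrite lerD ?ler_wpM2l// ler_wpM2r ?sqr_ge0// ler_wpM2l.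
Qed.

(** * Comparison with the Green function *)

(** The function [u], rescaled so as to agree with [G] at [o], may be smaller
    than [G] elsewhere. But then the minimum of the two is still admissible in
    the definition of [G]: at [o] it touches [G] from below, and away from [o]
    the right-hand side [1_o] vanishes. The minimality of [G] gives the
    bound. *)
Lemma green1_le (o : X) (G u : X -> R) : is_green1 b m o G ->
  formal_domain b u -> (forall x, 0 < u x) ->
  (forall x, 0 <= schroedinger b m (cst 1) u x) ->
  forall x, u o / G o * G x <= u x.
Proof.
move=> [[GD G0 GH] Gmin] uD u0 uH.
pose c := G o / u o; have c0 : 0 < c by rewrite divr_gt0.
pose phi x := Num.min (G x) (c * u x).
have phi0 x : 0 < phi x by rewrite lt_min G0 mulr_gt0.
have cuD : formal_domain b (fun x => c * u x) by exact: formal_domainZ.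
have phiD : formal_domain b phi.
  apply: formal_domain_le GD => // x.
  by rewrite (gtr0_norm (phi0 x)) (gtr0_norm (G0 x)) ge_min lexx.
have Gphi : forall x, G x <= phi x.
  apply: Gmin; split=> // x; have [Gcu|cuG] := leP (G x) (c * u x).
    apply: le_trans (GH x) _; apply: schroedinger_le => //.
      by move=> y; rewrite /phi ge_min lexx.
    by rewrite /phi min_l.
  have xo : x != o.
    by apply: contraTneq cuG => ->; rewrite /c divfK ?ltxx// gt_eqF.
  rewrite indicE in_set1 (negbTE xo).
  apply: (@le_trans _ _ (schroedinger b m (cst 1) (fun y => c * u y) x)).
    by rewrite schroedingerZ// mulr_ge0// ltW.
  apply: schroedinger_le => //.
    by move=> y; rewrite /phi ge_min lexx orbT.
  by rewrite /phi min_r// ltW.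
move=> x; have Gcu : G x <= c * u x.
  by rewrite (le_trans (Gphi x))// /phi ge_min lexx orbT.
have -> : u x = u o / G o * (c * u x).
  by rewrite /c; field; rewrite !gt_eqF.
by rewrite ler_wpM2l// divr_ge0// ltW.
Qed.

End SchroedingerOperators.

(** * Growth at infinity *)

Section AtInfinity.
Context {R : realType} {X : countType}.
Implicit Types (f u v : X -> R).

(** The finitely many vertices outside the neighbourhood of infinity only
    enlarge the constant, because [v] has no zeros. *)
Lemma bigO_inftyP u v : (forall x, 0 < v x) -> bigO_infty u v ->
  exists2 C : R, 0 <= C & forall x, `|u x| <= C * v x.
Proof.
move=> v0; rewrite /bigO_infty /limsup_infty limf_esupE.
case/ereal_inf_lt => _ [A finA <-] supA.
pose C1 : R := Num.max 0 (fine (ereal_sup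
  ((fun x : discrete_topology X => (`|u x| / `|v x|)%:E) @` A))).
have C10 : 0 <= C1 by rewrite /C1 le_max lexx.
have [s sE] := (finite_seqP _).1 finA.
pose C2 : R := \sum_(z <- s) `|u z| / `|v z|.
have C20 : 0 <= C2 by apply: sumr_ge0 => z _; rewrite divr_ge0.
exists (C1 + C2); first exact: addr_ge0.
move=> x; rewrite -ler_pdivrMr//.
have -> : `|u x| / v x = `|u x| / `|v x| by rewrite (ger0_norm (ltW (v0 x))).
have [Ax|nAx] := pselect (A x).
  rewrite -[leLHS]addr0 lerD// /C1 le_max; apply/orP; right.
  have le_sup : ((`|u x| / `|v x|)%:E <= ereal_sup
      ((fun x : discrete_topology X => (`|u x| / `|v x|)%:E) @` A))%E.
    by apply: ereal_sup_ubound; exists x.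
  rewrite -lee_fin fineK// fin_numElt supA andbT.
  exact: lt_le_trans (ltNyr _) le_sup.
have xs : x \in s by have : (~` A) x by []; rewrite sE.
rewrite -[leLHS]add0r lerD// /C2 (big_rem x xs)/= lerDl.
by apply: sumr_ge0 => z _; rewrite divr_ge0.
Qed.

Lemma le_liminf_infty f (c : R) : (forall x, c <= f x) ->
  (c%:E <= liminf_infty (fun x => (f x)%:E))%E.
Proof.
move=> cf; rewrite /liminf_infty limf_einfE.
apply: le_ereal_sup_tmp; exists (ereal_inf ((fun x => (f x)%:E) @` setT)).
  exists setT => //; rewrite /at_infinity /= setCT.
  exact: finite_set0.
by apply: le_ereal_inf_tmp => _ [x _ <-]; rewrite lee_fin.
Qed.

End AtInfinity.

(** * The uniqueness theorem *)

Theorem corollary3p3 (R : realType) (X : countType)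
  (X_infinite : infinite_set [set: X])
  (m : X -> R) (m_gt0 : forall x, 0 < m x)
  (b : X -> X -> R) (b_graph : is_graph b) (b_connected : connected_graph b)
  (V : X -> R) (V_le1 : forall x, V x <= 1)
  (H_positive : positive_op b m V)
  (o : X) (G1 : X -> R) (G1_green : is_green1 b m o G1)
  (W : X -> R) (W_ge0 : forall x, 0 <= W x)
  (W_critical : critical b m (fun x => - W x))
  (v : X -> R) (v_ground : agmon_ground_state b m (fun x => - W x) v)
  (u : X -> R) (u_harmonic : is_harmonic b m V u) (u_bigO : bigO_infty u v)
  (u_liminf : liminf_infty (fun x => (`|u x| / G1 x)%:E) = 0%E) :
  u = cst 0.
Proof.
have [v_pos v_harm _] := v_ground.
have v_super : is_superharmonic b m (fun x => - W x) v.
  by case: v_harm => vD vH; split=> // x; rewrite vH.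
have v0 := superharmonic_gt0 b_graph m_gt0 b_connected v_pos v_super.
have [w w_pos w_super] := H_positive; have [wD wH] := w_super.
have w0 := superharmonic_gt0 b_graph m_gt0 b_connected w_pos w_super.
have [C C0 uv] := bigO_inftyP v0 u_bigO.
have [c uw] : exists c, forall x, u x = c * w x.
  exists (u o / w o) => x.
  have <- : u x / w x = u o / w o; last by rewrite divfK// gt_eqF.
  pose P z := u z / w z = u o / w o.
  apply: (connected_propagate (P := P) b_connected _ _ erefl) => y z byz.
  by rewrite /P (ratio_edge b_graph m_gt0 W_critical v_harm v0 u_harmonic C0 uv
    w_super w0 byz).
have w1 x : 0 <= schroedinger b m (cst 1) w x.
  apply: le_trans (wH x) _; rewrite lerD2l ler_wpM2r//; exact: ltW.
have Gw := green1_le b_graph m_gt0 G1_green wD w0 w1.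
have G0 x : 0 < G1 x by case: G1_green => -[_ + _] _; apply.
have : ((`|c| * (w o / G1 o))%:E <= 0%:E :> \bar R)%E.
  rewrite -[leRHS]u_liminf; apply: le_liminf_infty => x.
  rewrite uw (normrM c (w x)) -[leRHS]mulrA ler_wpM2l// ler_pdivlMr//.
  by rewrite (le_trans (Gw x)) ?ler_norm.
rewrite lee_fin pmulr_lle0 ?divr_gt0// normr_le0 => /eqP c_eq0.
by apply/funext => x; rewrite uw c_eq0 mul0r.
Qed.
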